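(* In type $\tilde A$, the following relation holds for $n\ge 2$: $$\tilde A_n^{CFCI}(q)=\tilde A_{n-1}^{CFCI}(q)+q\,\tilde A_{n-2}^{CFCI}(q),$$ where $\tilde A_0^{CFCI}(q):=1$ and $\tilde A_1^{CFCI}(q)=1+2q$. Therefore, $$\tilde A^{CFCI}(x):=\sum_{n=1}^{\infty}\tilde A_{n-1}^{CFCI}(q)x^n=x\,\frac{1+2qx}{1-x-qx^2}.$$
   Context: For $n\ge3$, $\tilde A_{n-1}$ is the affine Coxeter group with generators $s_0,\dots,s_{n-1}$ whose Coxeter diagram is the $n$-cycle $s_0-s_1-\cdots-s_{n-1}-s_0$ (all edges $m=3$). $\tilde A_1$ is the group with two generators $s_0,s_1$ and $m_{s_0s_1}=\infty$; $\tilde A_0^{CFCI}(q):=1$ is a convention. An element of a Coxeter group $W$ (with length $\ell$) is fully commutative (FC) if any two of its reduced expressions are related by a sequence of transpositions of adjacent commuting generators. A cyclic shift of a word $s_{i_1}\cdots s_{i_k}$ is any word $s_{i_j}\cdots s_{i_k}s_{i_1}\cdots s_{i_{j-1}}$. An element is cyclically fully commutative (CFC) if every cyclic shift of every one of its reduced expressions is a reduced expression of an FC element; $W^{CFC}$ is the set of CFC elements. $I(W)=\{w\in W:w^2=1\}$ (including the identity), and $W^{CFCI}(q):=\sum_{w\in W^{CFC}\cap I(W)}q^{\ell(w)}$. *)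

(* Defs.v *)
From HB Require Import structures.
From Stdlib Require Export Relations.
From mathcomp Require Export all_boot all_order all_algebra finmap.
From mathcomp Require Export mathcomp_extra boolp classical_sets functions cardinality.

Set Implicit Arguments.
Unset Strict Implicit.
Unset Printing Implicit Defensive.

Import GRing.Theory.
Local Open Scope ring_scope.

(* Formal power series in one variable. *)
Record fps (R : Type) := Fps { fps_coef : nat -> R }.

HB.instance Definition _ (R : Type) := gen_eqMixin (fps R).
HB.instance Definition _ (R : Type) := gen_choiceMixin (fps R).

Lemma fpsP (R : Type) (f g : fps R) : (forall k, fps_coef f k = fps_coef g k) -> f = g.
Proof. by case: f g => [f] [g] /= fg; congr Fps; apply/funext. Qed.

Section FpsRing.
Variable R : comNzRingType.
Implicit Types f g h : fps R.

Definition fps_zero : fps R := Fps (fun=> 0).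
Definition fps_opp f : fps R := Fps (fun k => - fps_coef f k).
Definition fps_add f g : fps R := Fps (fun k => fps_coef f k + fps_coef g k).
Definition fps_one : fps R := Fps (fun k => (k == 0%N)%:R).
Definition fps_mul f g : fps R :=
  Fps (fun k => \sum_(i < k.+1) fps_coef f i * fps_coef g (k - i)).

Fact fps_addA : associative fps_add.
Proof. by move=> f g h; apply: fpsP => k /=; rewrite addrA. Qed.
Fact fps_addC : commutative fps_add.
Proof. by move=> f g; apply: fpsP => k /=; rewrite addrC. Qed.
Fact fps_add0 : left_id fps_zero fps_add.
Proof. by move=> f; apply: fpsP => k /=; rewrite add0r. Qed.
Fact fps_addN : left_inverse fps_zero fps_opp fps_add.
Proof. by move=> f; apply: fpsP => k /=; rewrite addNr. Qed.

HB.instance Definition _ :=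
  GRing.isZmodule.Build (fps R) fps_addA fps_addC fps_add0 fps_addN.

Definition fps_trunc n f : {poly R} := \poly_(i < n) fps_coef f i.

Lemma fps_mul_trunc n k f g : (k < n)%N ->
  fps_coef (fps_mul f g) k = (fps_trunc n f * fps_trunc n g)`_k.
Proof.
move=> kn; rewrite coefM; apply: eq_bigr => i _; rewrite !coef_poly.
have ik : (i < n)%N by apply: leq_trans kn; rewrite ltn_ord.
by rewrite ik (leq_ltn_trans (leq_subr i k) kn).
Qed.

Fact fps_mulA : associative fps_mul.
Proof.
move=> f g h; apply: fpsP => k.
pose T := fps_trunc k.+1.
have lhs : fps_coef (fps_mul f (fps_mul g h)) k = (T f * (T g * T h))`_k.
  rewrite coefM /=; apply: eq_bigr => i _.
  rewrite coef_poly ltn_ord -fps_mul_trunc //.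
  by rewrite ltnS leq_subr.
have rhs : fps_coef (fps_mul (fps_mul f g) h) k = (T f * T g * T h)`_k.
  rewrite coefM /=; apply: eq_bigr => i _.
  rewrite coef_poly ltnS leq_subr -fps_mul_trunc //.
by rewrite lhs rhs mulrA.
Qed.

Fact fps_mulC : commutative fps_mul.
Proof.
move=> f g; apply: fpsP => k.
by rewrite !(@fps_mul_trunc k.+1) // mulrC.
Qed.

Fact fps_mul1 : left_id fps_one fps_mul.
Proof.
move=> f; apply: fpsP => k /=.
rewrite big_ord_recl /= mul1r subn0 big1 ?addr0 // => i _.
by rewrite /= mul0r.
Qed.

Fact fps_mulDl : left_distributive fps_mul fps_add.
Proof.
move=> f g h; apply: fpsP => k /=.
by rewrite -big_split; apply: eq_bigr => i _; rewrite mulrDl.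
Qed.

Fact fps_oner_neq0 : fps_one != 0.
Proof.
apply/eqP => /(congr1 (fun f : fps R => fps_coef f 0%N)) /= /eqP.
by rewrite oner_eq0.
Qed.

HB.instance Definition _ := GRing.Zmodule_isComNzRing.Build (fps R)
  fps_mulA fps_mulC fps_mul1 fps_mulDl fps_oner_neq0.

Lemma fps_coef0 k : fps_coef (0 : fps R) k = 0. Proof. by []. Qed.
Lemma fps_coef1 k : fps_coef (1 : fps R) k = (k == 0%N)%:R. Proof. by []. Qed.
Lemma fps_coefN f k : fps_coef (- f) k = - fps_coef f k. Proof. by []. Qed.
Lemma fps_coefD f g k : fps_coef (f + g) k = fps_coef f k + fps_coef g k.
Proof. by []. Qed.
Lemma fps_coefM f g k :
  fps_coef (f * g) k = \sum_(i < k.+1) fps_coef f i * fps_coef g (k - i).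
Proof. by []. Qed.

Definition fpsC (c : R) : fps R := Fps (fun k => if k == 0%N then c else 0).
Definition fpsX : fps R := Fps (fun k => (k == 1%N)%:R).

End FpsRing.

Section FpsUnit.
Variable R : comUnitRingType.
Implicit Types f g h : fps R.

Definition fps_unit : {pred fps R} := [pred f | fps_coef f 0 \is a GRing.unit].

(* The coefficients g_0, ..., g_(n-1) of the inverse of f, which are          *)
(* determined by g_0 = 1 / f_0 and g_n = - (\sum_(i < n) g_i f_(n - i)) / f_0.*)
Fixpoint fps_inv_seq f n : seq R :=
  if n isn't n'.+1 then [::] else
  let s := fps_inv_seq f n' in
  rcons s (((n' == 0%N)%:R - \sum_(i < n') s`_i * fps_coef f (n' - i))
           / fps_coef f 0).

Definition fps_inv f : fps R :=
  if f \in fps_unit then Fps (fun n => (fps_inv_seq f n.+1)`_n) else f.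

Lemma size_fps_inv_seq f n : size (fps_inv_seq f n) = n.
Proof. by elim: n => //= n IHn; rewrite size_rcons IHn. Qed.

Lemma nth_fps_inv_seq f n i : (i < n)%N ->
  (fps_inv_seq f n)`_i = (fps_inv_seq f i.+1)`_i.
Proof.
elim: n => // n IHn; rewrite ltnS leq_eqVlt => /predU1P[-> //|i_n].
by rewrite [LHS]/= nth_rcons size_fps_inv_seq i_n IHn.
Qed.

Fact fps_mulVx : {in fps_unit, left_inverse 1 fps_inv *%R}.
Proof.
move=> f fU; apply: fpsP => n; rewrite fps_coefM.
have invE i : fps_coef (fps_inv f) i = (fps_inv_seq f i.+1)`_i.
  by rewrite /fps_inv fU.
rewrite big_ord_recr subnn invE /= nth_rcons size_fps_inv_seq ltnn eqxx.
rewrite divrK // addrC.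
under [X in _ + X]eq_bigr => i _ do rewrite invE -(@nth_fps_inv_seq f n) //.
by rewrite subrK.
Qed.

Fact fps_unitPl f g : g * f = 1 -> fps_unit f.
Proof.
move=> /(congr1 (fun h : fps R => fps_coef h 0)); rewrite fps_coefM big_ord1 /=.
by rewrite subn0 mulrC => gf; apply/unitrPr; exists (fps_coef g 0).
Qed.

Fact fps_inv_out : {in [predC fps_unit], fps_inv =1 id}.
Proof. by move=> f; rewrite inE /= /fps_inv => /negbTE ->. Qed.

HB.instance Definition _ := GRing.ComNzRing_hasMulInverse.Build (fps R)
  fps_mulVx fps_unitPl fps_inv_out.

Lemma fps_unitE f : (f \is a GRing.unit) = (fps_coef f 0 \is a GRing.unit).
Proof. by []. Qed.

End FpsUnit.

(* The entry 0 of a Coxeter matrix stands for m_{st} = oo. *)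
Record coxeter_matrix (S : finType) := CoxeterMatrix {
  cox_m :> S -> S -> nat;
  cox_m_diag : forall s, cox_m s s = 1%N;
  cox_m_sym : forall s t, cox_m s t = cox_m t s;
  cox_m_neq1 : forall s t, s != t -> cox_m s t != 1%N
}.

Local Open Scope quotient_scope.

Section CoxeterGroup.
Variables (S : finType) (M : coxeter_matrix S).
Implicit Types (a b u v : seq S) (s t : S).

(* The words over S modulo the congruence generated by (s t)^{m_{st}} = 1.    *)
(* For m_{st} = 0 the relator is the empty word, i.e. there is no relation.   *)
(* Since m_{ss} = 1, every generator is its own inverse, so the quotient      *)
(* monoid is the group with this presentation.                                *)
Definition cox_relator s t : seq S := flatten (nseq (M s t) [:: s; t]).

Inductive cox_step : seq S -> seq S -> Prop :=
  CoxStep u v s t : cox_step (u ++ cox_relator s t ++ v) (u ++ v).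

Definition cox_equiv : rel (seq S) :=
  fun a b => `[< clos_refl_sym_trans (seq S) cox_step a b >].

Fact cox_equiv_refl : reflexive cox_equiv.
Proof. by move=> a; apply/asboolP; apply: rst_refl. Qed.
Fact cox_equiv_sym : symmetric cox_equiv.
Proof. by move=> a b; apply/asboolP/asboolP => ab; apply: rst_sym. Qed.
Fact cox_equiv_trans : transitive cox_equiv.
Proof. by move=> b a c /asboolP ab /asboolP bc; apply/asboolP; apply: rst_trans ab bc. Qed.

Canonical cox_equiv_rel :=
  EquivRel cox_equiv cox_equiv_refl cox_equiv_sym cox_equiv_trans.

Definition coxeter_group := {eq_quot cox_equiv}.

HB.instance Definition _ := Choice.on coxeter_group.
HB.instance Definition _ := EqQuotient.on coxeter_group.

Definition word_class a : coxeter_group := \pi a.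

Lemma word_classP a b :
  word_class a = word_class b <-> clos_refl_sym_trans (seq S) cox_step a b.
Proof. by split=> [/eqmodP/asboolP|ab] //; apply/eqmodP/asboolP. Qed.

Lemma word_classK : cancel repr word_class.
Proof. exact: reprK. Qed.

Definition cox_mul (x y : coxeter_group) : coxeter_group :=
  word_class (repr x ++ repr y).
Definition cox_inv (x : coxeter_group) : coxeter_group := word_class (rev (repr x)).

Lemma cox_equiv_cat2 u v a b : clos_refl_sym_trans (seq S) cox_step a b ->
  clos_refl_sym_trans (seq S) cox_step (u ++ a ++ v) (u ++ b ++ v).
Proof.
elim=> {a b} [_ _ [u' v' s t]|a|a b _ ab|a b c _ ab _ bc].
- apply: rst_step; rewrite -!catA 2!(catA u).
  exact: CoxStep.
- exact: rst_refl.
- exact: rst_sym.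
- exact: rst_trans ab bc.
Qed.

Lemma cox_mulE a b : cox_mul (word_class a) (word_class b) = word_class (a ++ b).
Proof.
apply/word_classP; have rK c : clos_refl_sym_trans (seq S) cox_step
    (repr (word_class c)) c by apply/word_classP; rewrite word_classK.
apply: (@rst_trans _ _ _ (a ++ repr (word_class b))).
  exact: (cox_equiv_cat2 [::] _ (rK a)).
by have := cox_equiv_cat2 a [::] (rK b); rewrite !cats0.
Qed.

Fact cox_mulA : associative cox_mul.
Proof.
move=> x y z; rewrite -(word_classK x) -(word_classK y) -(word_classK z).
by rewrite !cox_mulE catA.
Qed.

Fact cox_mul1 : left_id (word_class [::]) cox_mul.
Proof. by move=> x; rewrite -(word_classK x) cox_mulE. Qed.

Fact cox_mulr1 : right_id (word_class [::]) cox_mul.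
Proof. by move=> x; rewrite -(word_classK x) cox_mulE cats0. Qed.

Lemma word_class_rev a : word_class (rev a ++ a) = word_class [::].
Proof.
elim: a => // s a IHa; rewrite rev_cons cat_rcons -{}IHa.
apply/word_classP; have := rst_step _ _ _ _ (CoxStep (rev a) a s s).
by rewrite /cox_relator cox_m_diag.
Qed.

Fact cox_mulV : left_inverse (word_class [::]) cox_inv cox_mul.
Proof. by move=> x; rewrite -{2}(word_classK x) cox_mulE word_class_rev. Qed.

Fact cox_mulrV : right_inverse (word_class [::]) cox_inv cox_mul.
Proof.
move=> x; rewrite -{1}(word_classK x) cox_mulE -{1}(revK (repr x)).
exact: word_class_rev.
Qed.

HB.instance Definition _ := isGroup.Build coxeter_group
  cox_mulA cox_mul1 cox_mulr1 cox_mulV cox_mulrV.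

Local Open Scope group_scope.

Definition cox_gen s : coxeter_group := word_class [:: s].

Definition word_val a : coxeter_group := \prod_(s <- a) cox_gen s.

Lemma word_valE a : word_val a = word_class a.
Proof.
rewrite /word_val; elim: a => [|s a IHa]; first by rewrite big_nil.
by rewrite big_cons IHa; apply: cox_mulE.
Qed.

Fact cox_word_exists (w : coxeter_group) :
  exists k, [exists a : k.-tuple S, word_val a == w].
Proof.
exists (size (repr w)); apply/existsP; exists (in_tuple (repr w)).
by rewrite word_valE word_classK.
Qed.

Definition cox_length (w : coxeter_group) : nat := ex_minn (cox_word_exists w).

Definition reduced_expr (w : coxeter_group) a : Prop :=
  word_val a = w /\ size a = cox_length w.

Inductive commutation_step : seq S -> seq S -> Prop :=
  CommutationStep u v s t of commute (cox_gen s) (cox_gen t) :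
    commutation_step (u ++ s :: t :: v) (u ++ t :: s :: v).

Definition fully_commutative (w : coxeter_group) : Prop :=
  forall a b, reduced_expr w a -> reduced_expr w b ->
    clos_refl_trans (seq S) commutation_step a b.

(* rot i a, for i : nat, ranges over the cyclic shifts of the word a. *)
Definition cyclically_fully_commutative (w : coxeter_group) : Prop :=
  forall a, reduced_expr w a -> forall i : nat,
    exists2 w', fully_commutative w' & reduced_expr w' (rot i a).

Definition CFCI : set coxeter_group :=
  [set w | cyclically_fully_commutative w /\ w ^+ 2 = 1].

Lemma finite_cox_length (A : set coxeter_group) k :
  finite_set [set w | A w /\ cox_length w = k].
Proof.
apply: (@sub_finite_set _ _ ((fun a : k.-tuple S => word_val a) @` setT)).
  move=> w [_]; rewrite /cox_length; case: ex_minnP => j /existsP[a /eqP aw] _ jk.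
  by rewrite -{}jk; exists a.
exact: finite_image.
Qed.

(* The formal sum \sum_(w in A) q^(l(w)); its coefficients are cardinals of   *)
(* sets that are finite by finite_cox_length.                                 *)
Definition length_series (A : set coxeter_group) : fps int :=
  Fps (fun k => (#|` fset_set [set w | A w /\ cox_length w = k]|)%:Z).

End CoxeterGroup.

(* The Coxeter matrix of type \tilde A_n on s_0, ..., s_n. The map ordS is    *)
(* i |-> i + 1 mod n + 1. *)
Definition affine_A_m n (i j : 'I_n.+1) : nat :=
  if i == j then 1%N
  else if n == 1%N then 0%N
  else if (j == ordS i) || (i == ordS j) then 3%N
  else 2%N.

Fact affine_A_diag n (i : 'I_n.+1) : affine_A_m i i = 1%N.
Proof. by rewrite /affine_A_m eqxx. Qed.
Fact affine_A_sym n (i j : 'I_n.+1) : affine_A_m i j = affine_A_m j i.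
Proof. by rewrite /affine_A_m eq_sym orbC. Qed.
Fact affine_A_neq1 n (i j : 'I_n.+1) : i != j -> affine_A_m i j != 1%N.
Proof. by rewrite /affine_A_m => /negbTE ->; case: (n == 1%N) => //; case: ifP. Qed.

Definition affine_A n : coxeter_matrix 'I_n.+1 :=
  CoxeterMatrix (@affine_A_diag n) (@affine_A_sym n) (@affine_A_neq1 n).

(* \tilde A_n^{CFCI}(q), with the convention \tilde A_0^{CFCI}(q) = 1. *)
Definition affine_A_CFCI (n : nat) : fps int :=
  if n is 0%N then 1 else length_series (@CFCI _ (affine_A n)).

(* \sum_(n >= 1) \tilde A_{n-1}^{CFCI}(q) x^n, a power series in x whose      *)
(* coefficients are power series in q.                                        *)
Definition affine_A_CFCI_series : fps (fps int) :=
  Fps (fun n => if n is m.+1 then affine_A_CFCI m else 0).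

(* Main.v *)
Require Import Defs.
From mathcomp Require Import ring.

Import GRing.Theory.
Local Open Scope ring_scope.

Set Implicit Arguments.
Unset Strict Implicit.
Unset Printing Implicit Defensive.

(** In every Coxeter group a CFC involution is a product of distinct, pairwise
    commuting generators. Let a be a reduced word of such an element w. As w is
    an involution, the reversal of a is another reduced word of w, so full
    commutativity links the two by commutations. These never change the relative
    order of two letters that do not commute, hence the subword of a on such a
    pair of letters is a palindrome. Let s be the first letter of a. The
    palindromes force every letter after the last s to commute with s. If that
    last s is not the first letter, it can be moved to the end of the word; a
    cyclic shift then begins with s s and is not reduced, a contradiction. So s
    occurs once and commutes with all other letters, and the rest of the word is
    treated by induction ([CFCI_commuting]).

    Conversely, let I be an independent set of the Coxeter graph. The product of
    I is a CFC involution of length #|I| that determines I, as soon as each word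
    for it uses all letters of I. This is read off a reflection representation:
    a word without the letter s fixes the coordinate s of every vector, while
    the product of I negates that of the simple root of s. With all entries of
    the Coxeter matrix at most 3 the representation is integral, and its
    relations are checked by ring identities ([relator_action]). Therefore the
    CFC involutions of the group have the independence polynomial of the Coxeter
    graph as their generating function ([length_series_CFCI]).

    For the cycle on n + 1 vertices this polynomial counts the circular binary
    words of length n + 1 without two adjacent 1s. Cutting the circle open and
    peeling off letters gives the recurrence ([circular_sum_rec]). The circular
    words of length 1 give 1, since their letter is adjacent to itself, so the
    convention in rank 0 fits. The closed form is the recurrence multiplied out. *)

(** * Commutation classes and CFC involutions in a Coxeter group *)

Section Words.
Variables (S : finType) (M : coxeter_matrix S).
Implicit Types (s t : S) (a b x y : seq S) (w : coxeter_group M).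
Local Notation gen := (cox_gen M).
Local Notation val := (word_val M).
Local Notation commutations := (clos_refl_trans (seq S) (@commutation_step S M)).
Local Open Scope group_scope.

Lemma word_val_cat a b : val (a ++ b) = val a * val b.
Proof. by rewrite /word_val big_cat. Qed.

Lemma word_val_cons s a : val (s :: a) = gen s * val a.
Proof. by rewrite /word_val big_cons. Qed.

Lemma word_val1 s : val [:: s] = gen s.
Proof. by rewrite /word_val big_seq1. Qed.

Lemma word_val_nil : val [::] = 1.
Proof. by rewrite /word_val big_nil. Qed.

Lemma word_val_rev a : val (rev a) = (val a)^-1.
Proof.
apply: (mulIg (val a)); rewrite mulVg -word_val_cat !word_valE.
exact: word_class_rev.
Qed.

Lemma cox_genK s : gen s * gen s = 1.
Proof.
by have := word_val_rev [:: s]; rewrite word_val1 => {1}->; rewrite mulVg.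
Qed.

Lemma cox_length_le a : (cox_length (val a) <= size a)%N.
Proof.
rewrite /cox_length; case: ex_minnP => k _; apply.
by apply/existsP; exists (in_tuple a).
Qed.

Lemma reduced_expr_exists w : exists a, reduced_expr w a.
Proof.
rewrite /reduced_expr /cox_length; case: ex_minnP => k /existsP[a /eqP aw] _.
by exists a; rewrite size_tuple.
Qed.

Lemma reduced_expr_min w a b :
  reduced_expr w a -> val b = w -> (size a <= size b)%N.
Proof. by move=> [_ ->] <-; apply: cox_length_le. Qed.

Lemma commute_word_val s a : {in a, forall t, commute (gen s) (gen t)} ->
  commute (gen s) (val a).
Proof.
elim: a => [|t a IHa] sa; first by rewrite word_val_nil; apply: commute1.
rewrite word_val_cons; apply: commuteM; first exact/sa/mem_head.
by apply: IHa => u ua; apply: sa; rewrite in_cons ua orbT.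
Qed.

(** A commutation step never swaps two letters that do not commute, so it does
    not touch the subword on such a pair. *)
Lemma commutation_filter s t a b : ~ commute (gen s) (gen t) ->
  commutations a b ->
  filter (pred2 s t) a = filter (pred2 s t) b.
Proof.
move=> st; elim=> {a b} [_ _ [u v p r pr]|//|a b c _ -> _ -> //].
rewrite !filter_cat /=; congr (_ ++ _).
have [ps|/negbTE ps] := boolP (pred2 s t p);
  have [rs|/negbTE rs] := boolP (pred2 s t r); rewrite /= in ps rs *;
  rewrite ?ps ?rs //.
by case/orP: ps pr => /eqP->; case/orP: rs => /eqP-> // pr; case: st.
Qed.

Lemma last_occurrence s a : s \in a ->
  exists b c, a = b ++ s :: c /\ s \notin c.
Proof.
elim: a => // t a IHa; rewrite in_cons.
case: (boolP (s \in a)) => [sa _|sa /[!orbF]/eqP<-]; last by exists [::], a.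
by have [b [c [-> sc]]] := IHa sa; exists (t :: b), c.
Qed.

(** What the commutation equivalence of a and its reversal leaves behind. *)
Definition palindromic a := forall s t, ~ commute (gen s) (gen t) ->
  rev (filter (pred2 s t) a) = filter (pred2 s t) a.

(** The part of the CFC condition that survives the removal of a letter
    commuting with the whole word; the induction below therefore uses it in place
    of the CFC condition. *)
Definition cyclically_reduced a := forall x y,
  perm_eq (x ++ y) a -> val (x ++ y) = val a ->
  reduced_expr (val (y ++ x)) (y ++ x).

Definition commuting a := {in a &, forall s t, commute (gen s) (gen t)}.

(** For t not commuting with s, the subword on s and t starts with s, hence also
    ends with s: no t can follow the last s. *)
Lemma palindromic_last s a b c : palindromic (s :: a) ->
  s :: a = b ++ s :: c -> s \notin c ->
  {in c, forall t, commute (gen s) (gen t)}.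
Proof.
move=> pal eq_a sc t tc.
case: (pselect (commute (gen s) (gen t))) => // /pal/(congr1 (head s)).
have -> : head s (filter (pred2 s t) (s :: a)) = s by rewrite /= eqxx.
rewrite eq_a filter_cat rev_cat /= eqxx /= rev_cons cat_rcons.
have: t \in filter (pred2 s t) c by rewrite mem_filter tc /= eqxx orbT.
case/lastP def_c: (filter _ c) => [//|d u] _; rewrite rev_rcons /= => us.
have : s \in filter (pred2 s t) c by rewrite def_c mem_rcons us mem_head.
by rewrite mem_filter (negPf sc) andbF.
Qed.

(** Induction on the word. The last occurrence of the first letter s commutes
    with everything after it. Either it is also the first occurrence, and s can be
    removed, or a cyclic shift of an equivalent word starts with s s. *)
Lemma palindromic_commuting a : palindromic a -> cyclically_reduced a ->
  uniq a /\ commuting a.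
Proof.
elim: a => // s a IHa pal red.
have [b [c [eq_a sc]]] := last_occurrence (mem_head s a).
have comm_c := palindromic_last pal eq_a sc.
case: b eq_a => [[eq_a]|_ b [_ eq_a]]; last first.
  (* The last s, moved to the end, cancels against the first one. *)
  have eq_val : val ((s :: b ++ c) ++ [:: s]) = val (s :: a).
    rewrite eq_a !(word_val_cat, word_val_cons, word_val_nil) mulg1 -!mulgA.
    by rewrite -(commute_word_val comm_c).
  have := red _ _ _ eq_val.
  have -> : perm_eq ((s :: b ++ c) ++ [:: s]) (s :: a).
    by rewrite eq_a /= perm_cons -catA perm_cat2l perm_catC.
  move=> /(_ isT) min_red.
  have := reduced_expr_min (b := b ++ c) min_red.
  rewrite /= !word_val_cons mulgA cox_genK mul1g => /(_ erefl).
  by rewrite ltnNge leqnSn.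
rewrite -eq_a in sc comm_c.
have [] := IHa.
- move=> p r npr; have := pal p r npr.
  have filter_nil t : ~ commute (gen s) (gen t) -> filter (pred2 s t) a = [::].
    move=> nst; rewrite -[RHS](filter_pred0 a); apply: eq_in_filter => u ua /=.
    apply/negP => /orP[/eqP us|/eqP ut]; first by rewrite -us ua in sc.
    by apply: nst; rewrite -ut; apply: comm_c.
  have [ps|nps] := eqVneq p s; first by rewrite ps filter_nil // -ps.
  have [rs|nrs] := eqVneq r s; last first.
    by rewrite /= [s == p]eq_sym [s == r]eq_sym (negPf nps) (negPf nrs).
  have -> : filter (pred2 p r) a = filter (pred2 r p) a.
    by apply: eq_filter => u /=; rewrite orbC.
  by rewrite rs filter_nil // => /commute_sym; rewrite -rs.
- (* If y ++ x had a shorter equivalent z, then s :: z would be too short for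
     the shift y ++ s :: x, because s commutes with y. *)
  move=> x y xy eq_val.
  have := red (s :: x) y; rewrite /= perm_cons !word_val_cons eq_val.
  move=> /(_ xy erefl) red_yx; split=> //; apply/eqP; rewrite eqn_leq.
  rewrite cox_length_le andbT.
  have [z [zv <-]] := reduced_expr_exists (val (y ++ x)).
  have := reduced_expr_min (b := s :: z) red_yx.
  rewrite word_val_cons zv !word_val_cat word_val_cons !mulgA.
  rewrite (commute_word_val (a := y)).
    by move=> /(_ erefl); rewrite !size_cat /= addnS ltnS.
  by move=> t ty; apply: comm_c; rewrite -(perm_mem xy) mem_cat ty orbT.
move=> ua ca; split=> [/=|]; first by rewrite sc.
move=> p r; rewrite !in_cons => /predU1P[->|pa] /predU1P[->|ra] //.
- exact: comm_c.
- exact/commute_sym/comm_c.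
- exact: ca.
Qed.

Lemma CFCI_commuting w : CFCI w ->
  exists a, [/\ val a = w, uniq a & commuting a].
Proof.
move=> [cfc w2]; have [a red_a] := reduced_expr_exists w.
have [aw size_a] := red_a.
have [] := @palindromic_commuting a; last by exists a.
- move=> s t nst; rewrite -filter_rev; apply/esym/commutation_filter => //.
  (* The trivial shift shows that w itself is fully commutative. *)
  have [w' fc [eq_w' _]] := cfc a red_a 0%N.
  rewrite rot0 aw in eq_w'; rewrite -{}eq_w' in fc; apply: fc => //.
  split; last by rewrite size_rev.
  by rewrite word_val_rev aw; apply: (mulgI w); rewrite mulgV -expg2.
- move=> x y xy eq_val.
  have red_xy : reduced_expr w (x ++ y).
    by split; rewrite ?eq_val // (perm_size xy).
  have [w' _] := cfc _ red_xy (size x).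
  by rewrite rot_size_cat => /[dup] -[->].
Qed.

Lemma commutations_cons s a b :
  commutations a b ->
  commutations (s :: a) (s :: b).
Proof.
elim=> {a b} [_ _ [u v p r pr]|a|a b c _ ab _ bc].
- exact: rt_step (CommutationStep (s :: u) v pr).
- exact: rt_refl.
- exact: rt_trans ab bc.
Qed.

Lemma commutations_front s a b : {in a, forall t, commute (gen s) (gen t)} ->
  commutations (a ++ s :: b) (s :: a ++ b).
Proof.
elim: a => [|t a IHa] sa; first exact: rt_refl.
apply: (@rt_trans _ _ _ (t :: s :: a ++ b)).
  by apply/commutations_cons/IHa => u ua; apply: sa; rewrite in_cons ua orbT.
exact/rt_step/(CommutationStep [::])/commute_sym/sa/mem_head.
Qed.

Lemma commutations_perm a b : commuting a -> perm_eq a b ->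
  commutations a b.
Proof.
elim: b a => [|s b IHb] a ca ab; first by rewrite (perm_nilP ab); apply: rt_refl.
have sa : s \in a by rewrite (perm_mem ab) mem_head.
case/splitPr: sa ca ab => x y ca ab.
apply: (@rt_trans _ _ _ (s :: x ++ y)).
  apply: commutations_front => t tx; apply: ca; rewrite mem_cat ?tx //.
  by rewrite mem_head orbT.
apply/commutations_cons/IHb.
  move=> p r pxy rxy; apply: ca;
    by rewrite mem_cat in_cons orbCA -mem_cat ?pxy ?rxy orbT.
by rewrite -(perm_cons s) -(permPr ab) -cat1s perm_catCA.
Qed.

Lemma commutations_val a b :
  commutations a b -> val a = val b.
Proof.
elim=> {a b} [_ _ [u v p r pr]|//|a b c _ -> _ -> //].
by rewrite !(word_val_cat, word_val_cons) !mulgA -(mulgA (val u)) pr mulgA.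
Qed.

(** If every word for the product uses all letters of a, then the reduced words
    are exactly the permutations of a. These are closed under cyclic shifts and
    reversal, and linked by commutations. *)
Lemma commuting_CFCI a : commuting a ->
  (forall b, val b = val a -> {subset a <= b}) -> uniq a ->
  CFCI (val a) /\ cox_length (val a) = size a.
Proof.
move=> ca supp ua.
have size_a : cox_length (val a) = size a.
  apply/eqP; rewrite eqn_leq cox_length_le.
  have [b [bv <-]] := reduced_expr_exists (val a).
  exact: uniq_leq_size (supp b bv).
have red_perm b : reduced_expr (val a) b -> perm_eq a b.
  move=> [bv bs]; apply: uniq_perm => //.
    by apply: (leq_size_uniq ua (supp b bv)); rewrite bs size_a.
  by case: (uniq_min_size ua (supp b bv)); rewrite // bs size_a.
have perm_red b : perm_eq a b -> reduced_expr (val a) b.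
  move=> ab; split; last by rewrite size_a (perm_size ab).
  by apply/esym/commutations_val/commutations_perm.
split=> //; split.
  move=> b /red_perm ab i; exists (val a); last first.
    by apply: perm_red; rewrite (permPl ab) perm_sym perm_rot.
  move=> x y /red_perm ax /red_perm ay; apply: commutations_perm.
    by move=> s t; rewrite -!(perm_mem ax); apply: ca.
  by rewrite -(permPl ax).
have [rv _] := perm_red (rev a) (etrans (perm_sym _ _) (permEl (perm_rev a))).
by rewrite expg2 -{2}rv word_val_rev mulgV.
Qed.

End Words.

(** * The reflection representation and independent sets *)

Section SimplyLaced.
Variables (S : finType) (M : coxeter_matrix S).
Hypothesis M_le3 : forall s t, (M s t <= 3)%N.
Implicit Types (s t : S) (a b : seq S) (v : S -> int) (I J : {set S}).

(** The simple reflection s in the coordinates given by the simple roots, for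
    the bilinear form with off-diagonal value -1/2 for m = 3 and m = oo. The value
    for m = oo is harmless, because an infinite entry imposes no relation. *)
Definition reflection s v : S -> int := fun t =>
  if t == s then - v s + \sum_(u | (u != s) && (M s u != 2%N)) v u else v t.

Definition word_action a v := foldr reflection v a.

(** In the coordinates s and t the reflections s and t act affinely, the rest of
    the vector entering through two constants; [update] and [outer] isolate them. *)
Definition update s t v (x y : int) : S -> int :=
  fun u => if u == s then x else if u == t then y else v u.

Definition outer s t v : int :=
  \sum_(u | [&& u != s, u != t & M s u != 2%N]) v u.

Lemma reflection_update s t v x y : s != t ->
  reflection s (update s t v x y) =
  update s t v (- x + y *+ (M s t != 2%N) + outer s t v) y.
Proof.
move=> st; apply/funext => u; rewrite /reflection /update.
case: (eqVneq u s) => // _; rewrite eqxx -addrA; congr (_ + _).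
rewrite big_mkcond (bigD1 t) //= [t == s]eq_sym (negPf st) eqxx /=.
rewrite mulrb; congr (_ + _).
rewrite /outer [RHS]big_mkcond [RHS](bigD1 t) //= eqxx andbF add0r.
by apply: eq_bigr => p pt; case: (eqVneq p s) => //= ps; rewrite pt (negPf pt).
Qed.

Lemma updateC s t v x y : s != t -> update s t v x y = update t s v y x.
Proof.
move=> st; apply/funext => u; rewrite /update.
by have [->|//] := eqVneq u s; rewrite (negPf st).
Qed.

Lemma update_id s t v : update s t v (v s) (v t) = v.
Proof. by apply/funext => u; rewrite /update; do 2?case: eqVneq => [->|_]. Qed.

Lemma reflectionK s : involutive (reflection s).
Proof.
move=> v; apply/funext => t; rewrite /reflection eqxx.
case: (eqVneq t s) => // ->.
rewrite opprD opprK -addrA [X in _ + X]addrC -sumrB big1 ?addr0 // => u.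
by case/andP=> /negPf->; rewrite subrr.
Qed.

(** The representation respects the Coxeter relations. For s <> t, both sides are
    explicit affine expressions in the coordinates s and t, one case for each of
    m = 0, 2, 3. *)
Lemma relator_action s t v : word_action (cox_relator M s t) v = v.
Proof.
have [->|st] := eqVneq s t.
  by rewrite /cox_relator cox_m_diag /= !reflectionK.
have refl_t x y : reflection t (update s t v x y) =
    update s t v x (- y + x *+ (M s t != 2%N) + outer t s v).
  rewrite (updateC _ _ _ st) reflection_update; last by rewrite eq_sym.
  by rewrite -(updateC _ _ _ st) cox_m_sym.
have := M_le3 s t; have := cox_m_neq1 M st.
rewrite /cox_relator -[v](update_id s t).
case def_m: (M s t) => [|[|[|[|m]]]] //= _ _;
  rewrite !(refl_t, reflection_update) // def_m /=; congr update; ring.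
Qed.

Lemma word_action_val a b v :
  word_val M a = word_val M b -> word_action a v = word_action b v.
Proof.
rewrite !word_valE => /word_classP; elim=> {a b} [_ _ [x y s t]|//|a b _ -> //|].
  by rewrite /word_action !foldr_cat [foldr _ _ (cox_relator M s t)]relator_action.
by move=> a b c _ -> _ ->.
Qed.

(** The reflection s changes the coordinate s only. *)
Lemma word_action_notin a v s : s \notin a -> word_action a v s = v s.
Proof.
elim: a => //= t a IHa; rewrite in_cons negb_or => /andP[/negPf st sa].
by rewrite /reflection st IHa.
Qed.

Definition simple_root s : S -> int := fun t => (t == s)%:R.

Lemma reflection_simple_root s t : s != t ->
  reflection t (simple_root s) t = (M t s != 2%N)%:R.
Proof.
move=> st; rewrite /reflection eqxx /simple_root [t == s]eq_sym (negPf st).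
rewrite oppr0 add0r.
rewrite big_mkcond (bigD1 s) //= st eqxx /= big1 ?addr0 => [|u /negPf->].
  by case: ifP.
by rewrite if_same.
Qed.

Lemma reflection_simple_root_self s : reflection s (simple_root s) s = -1.
Proof.
rewrite /reflection eqxx /simple_root eqxx big1 ?addr0 // => u.
by case/andP=> /negPf->.
Qed.

(** When m is neither 1 nor 2, the words s t and t s give the simple root of s
    the coordinates 1 and -1 at t. *)
Lemma commute_genP s t :
  commute (cox_gen M s) (cox_gen M t) <-> s = t \/ M s t = 2%N.
Proof.
split=> [st|[->|st]] //.
- have [|neq_st] := eqVneq s t; [by left|right]; apply/eqP/negPn/negP => Mst.
  have st2 : word_val M [:: s; t] = word_val M [:: t; s].
    by rewrite !word_val_cons word_val_nil !mulg1.
  have := congr1 (@^~ t) (word_action_val (simple_root s) st2).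
  have neq_ts : t != s by rewrite eq_sym.
  rewrite /= {1}/reflection (negPf neq_ts) reflection_simple_root // cox_m_sym Mst.
  have -> : reflection s (simple_root s) = fun u => - simple_root s u.
    apply/funext => u; have [->|us] := eqVneq u s.
      by rewrite reflection_simple_root_self /simple_root eqxx.
    by rewrite /reflection /simple_root (negPf us) oppr0.
  have -> : reflection t (fun u => - simple_root s u) t =
      - reflection t (simple_root s) t.
    by rewrite /reflection eqxx sumrN opprD.
  by rewrite reflection_simple_root // cox_m_sym Mst.
- have st2 : (word_val M [:: s; t] * word_val M [:: s; t] = 1)%g.
    rewrite -word_val_cat -(word_val_nil M) !word_valE.
    apply/word_classP/rst_step.
    by have := CoxStep M [::] [::] s t; rewrite /cox_relator st cats0.
  have := word_val_rev M [:: s; t]; rewrite /rev /= => ts.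
  have : word_val M [:: s; t] = word_val M [:: t; s].
    by apply: (mulgI (word_val M [:: s; t])); rewrite st2 ts mulgV.
  by rewrite !word_val_cons word_val_nil !mulg1.
Qed.

Definition independent (I : {set S}) : bool :=
  [forall s in I, forall t in I, (s != t) ==> (M s t == 2%N)].

Lemma independentP I :
  reflect {in I &, forall s t, s != t -> M s t = 2%N} (independent I).
Proof.
apply: (iffP forall_inP) => [ind s t sI tI st|ind s sI].
  by have /forall_inP/(_ t tI)/implyP/(_ st)/eqP := ind s sI.
by apply/forall_inP => t tI; apply/implyP => st; apply/eqP/ind.
Qed.

Lemma independent_commuting I : independent I <-> commuting M (enum I).
Proof.
split=> [/independentP ind s t|comm].
  rewrite !mem_enum => sI tI; apply/commute_genP.
  by have [|st] := eqVneq s t; [left|right; apply: ind].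
apply/independentP => s t sI tI st.
have /commute_genP[/eqP|//] : commute (cox_gen M s) (cox_gen M t).
  by apply: comm; rewrite mem_enum.
by rewrite (negPf st).
Qed.

(** The product over I maps the simple root of s in I to a vector with coordinate
    -1 at s: the other letters fix that root. A word without s keeps the
    coordinate 1. *)
Lemma independent_support I b : independent I ->
  word_val M b = word_val M (enum I) -> {subset enum I <= b}.
Proof.
move=> /independentP ind eq_val s sI; apply/negPn/negP => sb.
have := congr1 (@^~ s) (word_action_val (simple_root s) eq_val).
rewrite word_action_notin // {1}/simple_root eqxx.
have: {subset enum I <= I} by move=> t; rewrite mem_enum.
have := enum_uniq I; case/splitPr: sI => x y.
rewrite -cat1s uniq_catCA cat1s /= mem_cat negb_or => /andP[/andP[sx sy] _] subI.
rewrite /word_action foldr_cat -/(word_action _ _) word_action_notin //=.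
have sI : s \in I by apply: subI; rewrite mem_cat mem_head orbT.
have: {subset y <= I}.
  by move=> t ty; apply: subI; rewrite mem_cat in_cons ty !orbT.
suff fix_root : {subset y <= I} -> word_action y (simple_root s) = simple_root s.
  by move=> /fix_root; rewrite /word_action => ->; rewrite reflection_simple_root_self.
elim: y sy {subI eq_val} => //= t y IHy.
rewrite in_cons negb_or => /andP[st sy] subI.
rewrite IHy // => [|u uy]; last by apply: subI; rewrite in_cons uy orbT.
apply/funext => u; have [->|ut] := eqVneq u t; last first.
  by rewrite /reflection (negPf ut).
rewrite reflection_simple_root // cox_m_sym ind // ?subI ?mem_head //=.
by rewrite /simple_root eq_sym (negPf st).
Qed.

Definition independent_prod (I : {set S}) : coxeter_group M :=
  word_val M (enum I).

Lemma independent_prod_CFCI I : independent I ->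
  CFCI (independent_prod I) /\ cox_length (independent_prod I) = #|I|.
Proof.
move=> ind; rewrite cardE; apply: commuting_CFCI; last exact: enum_uniq.
- exact/independent_commuting.
- by move=> b; apply: independent_support.
Qed.

Lemma CFCI_independent :
  @CFCI S M = [set independent_prod I | I in [set I | independent I]]%classic.
Proof.
apply/seteqP; split=> [w /CFCI_commuting[a [<- ua ca]]|_ [I /= ind <-]].
  pose I := [set s in a].
  have aI : perm_eq a (enum I).
    by apply: uniq_perm; rewrite ?enum_uniq // => s; rewrite mem_enum inE.
  exists I; last by apply/esym/commutations_val/commutations_perm.
  by apply/independent_commuting => s t; rewrite -!(perm_mem aI); apply: ca.
by have [] := independent_prod_CFCI ind.
Qed.

Lemma independent_prod_inj : {in independent &, injective independent_prod}.
Proof.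
move=> I J indI indJ eqIJ; apply/setP => s; rewrite -(mem_enum I) -(mem_enum J).
have suppI := independent_support indI (esym eqIJ).
have suppJ := independent_support indJ eqIJ.
by apply/idP/idP => [/suppI|/suppJ].
Qed.

End SimplyLaced.

(** * Length generating function *)

Lemma fps_coef_sum (R : comNzRingType) (T : Type) (r : seq T) (P : pred T)
    (F : T -> fps R) k :
  fps_coef (\sum_(i <- r | P i) F i) k = \sum_(i <- r | P i) fps_coef (F i) k.
Proof. exact: (big_morph (fun f => fps_coef f k)). Qed.

Lemma fps_coefCM (R : comNzRingType) (c : R) (f : fps R) k :
  fps_coef (fpsC c * f) k = c * fps_coef f k.
Proof.
rewrite fps_coefM big_ord_recl subn0 big1 ?addr0 // => i _.
by rewrite mul0r.
Qed.

Lemma fps_coefXM0 (R : comNzRingType) (f : fps R) :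
  fps_coef (fpsX R * f) 0 = 0.
Proof. by rewrite fps_coefM big_ord1 mul0r. Qed.

Lemma fps_coefXMS (R : comNzRingType) (f : fps R) k :
  fps_coef (fpsX R * f) k.+1 = fps_coef f k.
Proof.
rewrite fps_coefM 2!big_ord_recl mul0r mul1r add0r subn1.
by rewrite big1 ?addr0 // => i _; rewrite mul0r.
Qed.

Lemma fps_coefXn (R : comNzRingType) n k :
  fps_coef (fpsX R ^+ n) k = (k == n)%:R.
Proof.
by elim: n k => [|n IHn] [|k] //; rewrite exprS (fps_coefXM0, fps_coefXMS).
Qed.

(** The products of independent sets are distinct, and the length of each is the
    size of its set. *)
Lemma length_series_CFCI (S : finType) (M : coxeter_matrix S) :
  (forall s t, (M s t <= 3)%N) ->
  length_series (@CFCI S M) = \sum_(I | independent M I) fpsX int ^+ #|I|.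
Proof.
move=> M_le3; apply: fpsP => k; rewrite fps_coef_sum /=.
have -> : fset_set [set w | CFCI w /\ cox_length w = k] =
    [fset independent_prod M I
       | I in [pred I : {set S} | independent M I && (#|I| == k)]]%fset.
  apply/fsetP => w; rewrite in_fset_set; last exact: finite_cox_length.
  apply/idP/imfsetP => [/set_mem[]|[I /=]].
    rewrite CFCI_independent // => -[I /= ind <-] <-.
    have [_ ->] := independent_prod_CFCI M_le3 ind.
    by exists I; rewrite // unfold_in /= ind eqxx.
  by move=> /andP[ind /eqP <-] ->; apply/mem_set/independent_prod_CFCI.
rewrite card_in_imfset /= => [|I J /andP[indI _] /andP[indJ _]]; last first.
  exact: independent_prod_inj.
rewrite -cardE -natz -sum1_card natr_sum big_mkcondr /=.
by apply: eq_bigr => I _; rewrite fps_coefXn eq_sym; case: eqP.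
Qed.

(** * Circular binary words without adjacent 1s *)

Definition not_both : rel bool := fun x y => ~~ (x && y).

Section CircularWords.
Variables (R : comNzRingType) (q : R).

(** The boundary letters x and y constrain the first and last letter of b, but
    carry no weight. *)
Definition linear_sum m (x y : bool) : R :=
  \sum_(b : m.-tuple bool | path not_both x (rcons b y)) q ^+ count id b.

Definition circular_sum m : R :=
  \sum_(b : m.-tuple bool | cycle not_both b) q ^+ count id b.

Lemma big_tuple_bool m (P : pred (seq bool)) (F : seq bool -> R) :
  \sum_(b : m.+1.-tuple bool | P b) F b =
  \sum_(b : m.-tuple bool | P (false :: b)) F (false :: b) +
  \sum_(b : m.-tuple bool | P (true :: b)) F (true :: b).
Proof.
pose h (p : bool * m.-tuple bool) := [tuple of p.1 :: p.2].
have h_bij : bijective h.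
  exists (fun b : m.+1.-tuple bool => (thead b, [tuple of behead b])).
    by case=> x b; congr pair; apply/val_inj.
  by move=> b; rewrite [RHS]tuple_eta.
rewrite (reindex h) /=; last exact: onW_bij.
rewrite -(pair_big_dep predT (fun x (b : m.-tuple bool) => P (x :: b))
  (fun x b => F (x :: b))) /=.
by rewrite big_bool /= addrC.
Qed.

Lemma big_tuple0 (P : pred (seq bool)) (F : seq bool -> R) :
  \sum_(b : 0.-tuple bool | P b) F b = if P [::] then F [::] else 0.
Proof.
rewrite big_mkcond (bigD1 [tuple]) //= big1 ?addr0 // => b /eqP[].
exact: tuple0.
Qed.

Lemma linear_sum0 x y : linear_sum 0 x y = (not_both x y)%:R.
Proof.
rewrite /linear_sum (big_tuple0 (fun b => path not_both x (rcons b y))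
  (fun b => q ^+ count id b)).
by rewrite /= andbT; case: not_both.
Qed.

Lemma linear_sum_false m y :
  linear_sum m.+1 false y = linear_sum m false y + q * linear_sum m true y.
Proof.
rewrite /linear_sum (big_tuple_bool _
  (fun b => path not_both false (rcons b y)) (fun b => q ^+ count id b)) /=.
by congr (_ + _); rewrite mulr_sumr; apply: eq_bigr => b _; rewrite add1n exprS.
Qed.

Lemma linear_sum_true m y : linear_sum m.+1 true y = linear_sum m false y.
Proof.
rewrite /linear_sum (big_tuple_bool _
  (fun b => path not_both true (rcons b y)) (fun b => q ^+ count id b)) /=.
by rewrite big_pred0_eq addr0.
Qed.

(** Cut the circle at its first letter, which is then the boundary letter on both
    sides. *)
Lemma circular_sumE m :
  circular_sum m.+1 = linear_sum m false false + q * linear_sum m true true.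
Proof.
rewrite /circular_sum (big_tuple_bool _ (cycle not_both)
  (fun b => q ^+ count id b)) /=.
by congr (_ + _); rewrite mulr_sumr; apply: eq_bigr => b _; rewrite add1n exprS.
Qed.

Lemma circular_sum1 : circular_sum 1 = 1.
Proof. by rewrite circular_sumE !linear_sum0 mulr0 addr0. Qed.

Lemma circular_sum2 : circular_sum 2 = 1 + 2 * q.
Proof.
rewrite circular_sumE linear_sum_false linear_sum_true !linear_sum0 /=; ring.
Qed.

(** Both summands of [circular_sumE] satisfy this recurrence, the transfer matrix
    with rows (1, q) and (1, 0) having characteristic polynomial T^2 - T - q. *)
Lemma circular_sum_rec m :
  circular_sum m.+3 = circular_sum m.+2 + q * circular_sum m.+1.
Proof.
rewrite !circular_sumE !linear_sum_true !linear_sum_false !linear_sum_true; ring.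
Qed.

End CircularWords.

(** * Affine type A *)

Lemma affine_A_le3 n (s t : 'I_n.+1) : (affine_A n s t <= 3)%N.
Proof. by rewrite /= /affine_A_m; do 3?case: ifP. Qed.

Lemma cycle_tupleP (T : Type) (e : rel T) n (b : n.+1.-tuple T) :
  reflect (forall i, e (tnth b i) (tnth b (ordS i))) (cycle e b).
Proof.
case: b => -[//|x p] /= size_p; have /eqP[sz] := size_p.
apply: (iffP (pathP x)) => ep i; rewrite size_rcons sz in ep *.
- have := ep i (ltn_ord i); rewrite !(tnth_nth x) /= -rcons_cons !nth_rcons /=.
  rewrite sz ltn_ord; case: (ltngtP i n) (ltn_ord i) => [ltin|ltni|->] lein.
  + by rewrite modn_small.
  + by rewrite ltnS leqNgt ltni in lein.
  + by rewrite modnn.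
- move=> lein; have := ep (Ordinal lein); rewrite !(tnth_nth x) /=.
  rewrite -rcons_cons !nth_rcons /= sz lein.
  case: (ltngtP i n) lein => [ltin|ltni|->] lein.
  + by rewrite modn_small.
  + by rewrite ltnS leqNgt ltni in lein.
  + by rewrite modnn.
Qed.

Lemma ordS_neq n (i : 'I_n.+2) : ordS i != i.
Proof.
apply/eqP => /(congr1 val) /=.
case: (ltngtP i n.+1) (ltn_ord i) => [ltin|ltni|->] lein.
- by rewrite modn_small // => /eqP; rewrite eqn_leq ltnn.
- by rewrite ltnS leqNgt ltni in lein.
- by rewrite modnn.
Qed.

(** This includes rank 1, where i and j are each other's successors and their
    entry is the 0 that encodes oo. *)
Lemma affine_A_m_eq2 n (i j : 'I_n.+2) : i != j ->
  (affine_A n.+1 i j == 2%N) = ~~ ((j == ordS i) || (i == ordS j)).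
Proof.
move=> ij; rewrite /= /affine_A_m (negPf ij).
case: n i j ij => [|n] i j ij; last by case: ifP.
by case: i ij => [[|[|i]] ilt] //; case: j => [[|[|j]] jlt] //; rewrite -!val_eqE.
Qed.

Lemma independent_affine_A n (b : n.+2.-tuple bool) :
  independent (affine_A n.+1) [set i | tnth b i] = cycle not_both b.
Proof.
apply/independentP/cycle_tupleP => [ind i|cyc i j bi bj ij].
  apply/negP => /andP[bi bSi].
  have := ordS_neq i; rewrite eq_sym => iSi.
  by have := affine_A_m_eq2 iSi; rewrite ind ?inE // !eqxx //.
rewrite !inE in bi bj; apply/eqP; rewrite affine_A_m_eq2 //.
apply/negP => /orP[]/eqP eq_S.
  by have := cyc i; rewrite -eq_S /not_both bi bj.
by have := cyc j; rewrite -eq_S /not_both bi bj.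
Qed.

(** Independent sets are encoded by their indicator words. In rank 0 the letter of
    a circular word of length 1 is adjacent to itself, so only the word 0 counts;
    this agrees with the convention. *)
Lemma affine_A_CFCI_circular n : affine_A_CFCI n = circular_sum (fpsX int) n.+1.
Proof.
case: n => [|n]; first by rewrite circular_sum1.
rewrite [LHS]length_series_CFCI; last exact: affine_A_le3.
pose h (b : n.+2.-tuple bool) := [set i | tnth b i].
have h_bij : bijective h.
  exists (fun I : {set 'I_n.+2} => [tuple i \in I | i < n.+2]) => [b|I].
    by apply: eq_from_tnth => i; rewrite tnth_mktuple inE.
  by apply/setP => i; rewrite inE tnth_mktuple.
rewrite (reindex h) /=; last exact: onW_bij.
apply: eq_big => b; first exact: independent_affine_A.
by move=> _; congr (_ ^+ _); rewrite cardsE -sum1_card -sum1_count big_tuple.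
Qed.

Theorem theorem4p5 :
  let q : fps int := fpsX int in
  let x : fps (fps int) := fpsX (fps int) in
  [/\ affine_A_CFCI 0 = 1,
      affine_A_CFCI 1 = 1 + 2 * q,
      forall n : nat, (2 <= n)%N ->
        affine_A_CFCI n = affine_A_CFCI (n - 1) + q * affine_A_CFCI (n - 2)
    & affine_A_CFCI_series =
        x * ((1 + 2 * fpsC q * x) / (1 - x - fpsC q * x ^+ 2))].
Proof.
move=> q x.
have CFCI0 : affine_A_CFCI 0 = 1 by [].
have CFCI1 : affine_A_CFCI 1 = 1 + 2 * q.
  by rewrite affine_A_CFCI_circular circular_sum2.
have CFCI_rec n : affine_A_CFCI n.+2 = affine_A_CFCI n.+1 + q * affine_A_CFCI n.
  by rewrite !affine_A_CFCI_circular circular_sum_rec.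
split=> // [[|[|n]] // _|]; first by rewrite CFCI_rec !subSS !subn0.
have denom_unit : 1 - x - fpsC q * x ^+ 2 \is a GRing.unit.
  rewrite fps_unitE !fps_coefD !fps_coefN fps_coefCM expr2 !fps_coefXM0.
  by rewrite mulr0 !subr0 unitr1.
rewrite mulrA; apply: (canRL (mulrK denom_unit)).
have -> : affine_A_CFCI_series * (1 - x - fpsC q * x ^+ 2) =
  affine_A_CFCI_series - x * affine_A_CFCI_series
    - fpsC q * (x * (x * affine_A_CFCI_series)) by ring.
have -> : x * (1 + 2 * fpsC q * x) = x * 1 + fpsC q * (x * (x * 2)) by ring.
have coefS m : fps_coef affine_A_CFCI_series m.+1 = affine_A_CFCI m by [].
have coef0 : fps_coef affine_A_CFCI_series 0 = 0 by [].
(* Beyond the coefficient of x^2 the right-hand side vanishes, and the claim is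
   the recurrence; lower coefficients are the initial values. *)
apply: fpsP => k; rewrite !(fps_coefD, fps_coefN, fps_coefCM).
case: k => [|[|[|k]]]; rewrite !(fps_coefXM0, fps_coefXMS) ?(coefS, coef0).
- by rewrite !mulr0 !subr0 ?addr0.
- by rewrite CFCI0 !mulr0 !subr0 ?addr0.
- by rewrite CFCI1 CFCI0 mulr0 subr0 fps_coefD fps_coef1 /=; ring.
- by rewrite CFCI_rec !fps_coefD !fps_coef1 /=; ring.
Qed.
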